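(* Let $k,m$ be integers with $k\ge m\ge 2$, and let $M$ be the minimum number of $(m-1)$-dimensional linear subspaces of $\mathbb{R}^m$ whose union contains the grid $K=\{\mathbf{x}\in\mathbb{Z}^m : \|\mathbf{x}\|_\infty\le k\}$. Then $$M\ge \frac{k^{m/(m-1)}}{2m-2}.$$
   Context: For $\mathbf{x}=(x_1,\dots,x_m)\in\mathbb{R}^m$, $\|\mathbf{x}\|_\infty=\max_{1\le i\le m}|x_i|$. Linear subspaces pass through the origin. *)

(* Defs.v *)
From HB Require Import structures.
From mathcomp Require Import all_boot all_order all_algebra finmap.
From mathcomp Require Import all_classical all_reals all_analysis.
From mathcomp Require Import zify.
Set Implicit Arguments.
Unset Strict Implicit.
Unset Printing Implicit Defensive.
Import Order.TTheory GRing.Theory Num.Theory.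
Import numFieldNormedType.Exports.
Local Open Scope classical_set_scope.
Local Open Scope ring_scope.

(* The norm of the library on 'rV[R]_m is the sup norm. *)
Definition grid (R : realType) (m k : nat) : set 'rV[R]_m :=
  [set x | (exists z : 'rV[int]_m, x = map_mx intr z) /\ `|x| <= k%:R].
Arguments grid : clear implicits.

Definition hyperplane_cover (R : realType) (m : nat) (K : set 'rV[R]_m)
    (S : {fset {vspace 'rV[R]_m}}) : Prop :=
  (forall V, V \in S -> \dim V = (m - 1)%N) /\
  K `<=` \bigcup_(V in [set` S]) [set x | x \in V].

Definition coverable (R : realType) (m k : nat) : pred nat := fun n =>
  `[< exists2 S : {fset {vspace 'rV[R]_m}},
        hyperplane_cover (grid R m k) S & #|` S|%fset = n >].
Arguments coverable : clear implicits.

Lemma dim_ker_functional (R : realType) (m : nat) (a : 'cV[R]_m) :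
  a != 0 -> \dim (lker (linfun (mulmxr a : 'rV[R]_m -> 'rV[R]_1))) = (m - 1)%N.
Proof.
move=> a0; set f := linfun _.
have := limg_ker_dim f fullv; rewrite capfv !dimvf /dim /= mul1n.
suff -> : \dim (limg f) = 1%N by move=> /(congr1 (subn^~ 1%N)); rewrite addnK.
apply/eqP; rewrite eqn_leq; apply/andP; split.
  by have := dimvS (subvf (limg f)); rewrite dimvf /dim /= mul1n.
rewrite lt0n dimv_eq0; apply: contra a0 => /eqP f0.
apply/eqP/matrixP => i j; rewrite ord1 mxE.
have : f (delta_mx 0 i) \in limg f by rewrite memv_img ?memvf.
rewrite f0 memv0 lfunE /= -rowE => /eqP /matrixP /(_ 0 0).
by rewrite !mxE.
Qed.

Lemma ex_coverable (R : realType) (m k : nat) :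
  (2 <= m)%N -> exists n, coverable R m k n.
Proof.
case: m => [//|[//|m]] _.
pose i1 : 'I_m.+2 := lift ord0 ord0.
pose v (p : 'I_(k + k).+1) : R := (p%:Z - k%:Z)%:~R.
pose w (p : 'I_(k + k).+1 * 'I_(k + k).+1) : 'cV[R]_m.+2 :=
  v p.2 *: delta_mx ord0 ord0 - v p.1 *: delta_mx i1 ord0.
pose a p := if w p == 0 then delta_mx ord0 ord0 else w p.
have a0 p : a p != 0.
  rewrite /a; case: ifPn => // _; apply/eqP => /matrixP /(_ ord0 ord0).
  by rewrite !mxE /= => /eqP; rewrite oner_eq0.
pose H p := lker (linfun (mulmxr (a p) : 'rV[R]_m.+2 -> 'rV[R]_1)).
pose S : {fset {vspace 'rV[R]_m.+2}} := seq_fset tt [seq H p | p : 'I_(k + k).+1 * 'I_(k + k).+1].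
exists #|` S|%fset; apply/asboolP; exists S => //; split.
  by move=> V; rewrite seq_fsetE => /mapP[p _ ->]; exact: dim_ker_functional.
move=> _ [[z ->] zk].
have zi i : exists p, (z 0 i)%:~R = v p.
  have : `|(z 0 i)%:~R : R| <= k%:R.
    apply: le_trans zk; rewrite [leRHS]/Num.norm /= mx_normrE.
    by apply/bigmax_geP; right; exists (0, i) => //=; rewrite mxE.
  rewrite -intr_norm -[k%:R]/(k%:Z%:~R) ler_int => zk'.
  have h : (absz (z 0 i + k%:Z)%R < (k + k).+1)%N by lia.
  exists (Ordinal h); rewrite /v /=; congr (_%:~R); lia.
have [p0 e0] := zi ord0; have [p1 e1] := zi i1.
exists (H (p0, p1)).
  by rewrite /= seq_fsetE; apply/mapP; exists (p0, p1); rewrite ?mem_enum.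
rewrite /= memv_ker lfunE /=; apply/eqP/matrixP => i j; rewrite !ord1 {i j}.
rewrite /a; case: ifPn => [/eqP /matrixP w0|_].
  rewrite -colE !mxE e0.
  have := w0 i1 0; rewrite !mxE /= => /eqP.
  by rewrite mulr0 sub0r mulr1 oppr_eq0 => /eqP.
rewrite mulmxBr -!scalemxAr -!colE !mxE e0 e1 /=.
by rewrite mulrC subrr.
Qed.

(* For m = 1 the only 0-dimensional subspace misses nonzero grid points, so the
   minimum is only defined for 2 <= m. *)
Definition min_cover (R : realType) (m k : nat) (hm : (2 <= m)%N) : nat :=
  ex_minn (ex_coverable R k hm).
Arguments min_cover : clear implicits.

(* Main.v *)
Require Import Defs.
From mathcomp Require Import all_boot all_order all_algebra finmap.
From mathcomp Require Import all_classical all_reals all_analysis.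
From mathcomp Require Import zify.
Set Implicit Arguments.
Unset Strict Implicit.
Unset Printing Implicit Defensive.
Import Order.TTheory GRing.Theory Num.Theory.
Local Open Scope nat_scope.

(** The grid contains many points of which no [m] lie on a common hyperplane
    through the origin; each hyperplane of a cover then accounts for at most
    [m - 1] of them, so a cover needs at least their number divided by
    [m - 1] hyperplanes.

    Such points come from the moment curve over a prime field.  Let [p] be a
    prime with [p ^ (m - 1) <= k ^ m].  For each [t] in F_p, the integer
    vectors that are proportional to [(1, t, ..., t ^ (m - 1))] modulo [p] form
    a lattice of index [p ^ (m - 1)], and the pigeonhole principle
    ([ex_short_moment_multiple]) gives a nonzero one, [x_t], whose entries are
    at most [p ^ ((m - 1) / m) <= k] in absolute value.  These entries are
    smaller than [p], so [x_t] is not zero modulo [p].  For [m] distinct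
    parameters the determinant of the [x_t] is, modulo [p], a Vandermonde
    determinant times nonzero scalars; it is nonzero in F_p, hence in Z, hence
    in R ([moment_multiples_unitmx]).  So [p <= M * (m - 1)]
    ([hyperplane_cover_card]).

    It remains to find a prime in the upper half of the range allowed by
    [p ^ (m - 1) <= k ^ m], that is, with [k ^ (m / (m - 1)) <= 2 p].  This is
    exactly Bertrand's postulate ([bertrand]), and the loss of the factor 2 is
    the 2 in the denominator of the bound.  It is proved by Erdos's argument:
    if there were no prime between [n] and [2 n], the primes dividing the
    central binomial coefficient ['C(2n, n)] would be at most [2 n / 3], those
    above [sqrt (2 n)] would occur with exponent at most 1, and every prime power in it
    would be at most [2 n].  As the product of the primes up to [2 n / 3] is at
    most [4 ^ (2 n / 3)], this makes ['C(2n, n)] smaller than [4 ^ n / (2 n)]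
    as soon as [n] is large, against [exp4_leq_bin]. *)

(** * Integer roots *)

Lemma ex_iroot e n : 0 < e -> exists r, r ^ e <= n < r.+1 ^ e.
Proof.
move=> e0; have ex0 : exists r, r ^ e <= n by exists 0; rewrite exp0n.
have le_n r : r ^ e <= n -> r <= n.
  apply: leq_trans; case: e {ex0} e0 => // e _.
  by case: r => // r; rewrite expnS leq_pmulr ?expn_gt0.
case: (ex_maxnP ex0 le_n) => r rP rmax; exists r; rewrite rP ltnNge /=.
by apply/negP => /rmax; rewrite ltnn.
Qed.

(** * Products of primes *)

Lemma dvdn_prod_primes (s : seq nat) N :
  uniq s -> {in s, forall p, prime p && (p %| N)} -> \prod_(p <- s) p %| N.
Proof.
elim: s => [|p s IHs] /=; first by rewrite big_nil dvd1n.
case/andP=> ps us sP; rewrite big_cons.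
have /andP[p_pr pN] := sP p (mem_head _ _).
have sP' : {in s, forall q, prime q && (q %| N)}.
  by move=> q qs; apply: sP; rewrite inE qs orbT.
rewrite Gauss_dvd ?pN ?IHs // big_seq.
elim/big_rec: _ => [|q x qs cpx]; first exact: coprimen1.
rewrite coprimeMr cpx andbT prime_coprime //.
have /andP[q_pr _] := sP' q qs.
by rewrite dvdn_prime2 //; apply: contraNneq ps => ->.
Qed.

(** Such a prime divides [n`!] but neither of the factorials [m`!] and
    [(n - m)`!]. *)
Lemma prime_dvd_bin_above p n m :
  prime p -> m < p -> n - m < p -> p <= n -> p %| 'C(n, m).
Proof.
move=> p_pr mp nmp pn.
have fact_ndvd k : k < p -> ~~ (p %| k`!).
  elim: k => [|k IHk] kp.
    by rewrite fact0 dvdn1 neq_ltn prime_gt1 ?orbT.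
  by rewrite factS Euclid_dvdM // negb_or IHk ?gtnNdvd // ltnW.
have : p %| n`! by rewrite dvdn_fact // prime_gt0.
rewrite -(@bin_fact n m); last by lia.
by rewrite !Euclid_dvdM // (negPf (fact_ndvd _ mp)) (negPf (fact_ndvd _ nmp)) !orbF.
Qed.

(** ['C(2m + 1, m)] occurs twice in the expansion of [(1 + 1) ^ (2m + 1)]. *)
Lemma leq_bin_half m : 'C(m.*2.+1, m) <= 4 ^ m.
Proof.
suff : 'C(m.*2.+1, m) + 'C(m.*2.+1, m.+1) <= 2 ^ m.*2.+1.
  rewrite -(@bin_sub m.*2.+1 m.+1); last by lia.
  rewrite (_ : m.*2.+1 - m.+1 = m); last by lia.
  by rewrite addnn -mul2n expnS leq_pmul2l // -mul2n expnM.
have := expnDn 1 1 m.*2.+1; rewrite addn1 => ->.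
have lt1 : m < m.*2.+2 by lia.
have lt2 : m.+1 < m.*2.+2 by lia.
rewrite (bigD1 (Ordinal lt1)) //= (bigD1 (Ordinal lt2)) //=; last first.
  by rewrite -val_eqE /=; lia.
by rewrite !exp1n !muln1 addnA leq_addr.
Qed.

(** Chebyshev's bound.  For odd [n = 2m + 1], the primes above [m + 1] all divide
    ['C(2m + 1, m) <= 4 ^ m] and induction handles the others; an even [n > 2]
    is not prime, so that [n - 1] can replace it. *)
Lemma prod_primes_leq n (s : seq nat) :
  uniq s -> {in s, forall p, prime p && (p <= n)} -> \prod_(p <- s) p <= 4 ^ n.
Proof.
elim/ltn_ind: n s => n IHn s us sP.
have [n_le2|n_gt2] := leqP n 2.
  have : \prod_(p <- s) p %| 2.
    apply: dvdn_prod_primes => // p ps.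
    have /andP[p_pr pn] := sP p ps; rewrite p_pr /=.
    by have := prime_gt1 p_pr => p1; have -> : p = 2 by lia.
  case: n n_le2 {IHn} sP => [|n] n_le2 sP sd.
    case: s sP {us sd} => [|p s] sP; first by rewrite big_nil.
    by have /andP[/prime_gt0 p0] := sP p (mem_head _ _); rewrite leqNgt p0.
  apply: leq_trans (dvdn_leq _ sd) _ => //; rewrite expnS.
  by rewrite (leq_trans (_ : 2 <= 4)) // leq_pmulr // expn_gt0.
have [n_odd|n_even] := boolP (odd n); last first.
  apply: leq_trans (IHn n.-1 _ s us _) _; [lia| |by rewrite leq_exp2l; lia].
  move=> p ps; have /andP[p_pr pn] := sP p ps; rewrite p_pr /=.
  have : p != n.
    apply: contraNneq n_even => pE.
    by case: (even_prime p_pr) => [p2|]; [lia|rewrite pE].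
  by lia.
pose m := n./2; have nE : n = m.*2.+1 by lia.
rewrite (bigID (fun p => p <= m.+1)) /= nE.
rewrite (_ : 4 ^ m.*2.+1 = 4 ^ m.+1 * 4 ^ m); last first.
  by rewrite -expnD; congr (_ ^ _); lia.
rewrite -!(big_filter s); apply: leq_mul.
  apply: IHn; [lia|exact: filter_uniq|move=> p].
  by rewrite mem_filter => /andP[-> /sP/andP[->]].
apply: leq_trans (leq_bin_half m).
apply: dvdn_leq; first by rewrite bin_gt0; lia.
apply: dvdn_prod_primes; first exact: filter_uniq.
move=> p; rewrite mem_filter => /andP[pm /sP/andP[p_pr pn]].
by rewrite p_pr prime_dvd_bin_above //; lia.
Qed.

(** * The central binomial coefficient *)

Lemma exp4_leq_bin n : 0 < n -> 4 ^ n <= n.*2 * 'C(n.*2, n).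
Proof.
elim: n => [//|[|n] IHn] _; first by [].
have {}IHn := IHn isT; set k := n.+1 in IHn *.
have e1 : k.+1 * 'C(k.*2.+1, k.+1) = k.*2.+1 * 'C(k.*2, k).
  by rewrite -mul_bin_diag.
have e2 : k.+1 * 'C(k.+1.*2, k.+1) = k.+1.*2 * 'C(k.*2.+1, k.+1).
  rewrite -mul_bin_diag doubleS /=; congr (_ * _).
  by rewrite -bin_sub; [congr 'C(_, _)|]; lia.
have : 4 ^ k.+1 <= 4 * (k.*2 * 'C(k.*2, k)) by rewrite expnS leq_mul2l IHn orbT.
move/leq_trans; apply.
rewrite (_ : k.+1.*2 * 'C(k.+1.*2, k.+1) = 4 * (k.*2.+1 * 'C(k.*2, k))); last first.
  by rewrite -[X in X * _ = _]mul2n -mulnA e2 -e1 -[X in 2 * (X * _)]mul2n -mulnA mulnA.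
by rewrite leq_mul2l leq_mul2r leqnSn !orbT.
Qed.

Lemma divn_double_bounds n d : n %/ d + n %/ d <= n.*2 %/ d <= (n %/ d + n %/ d).+1.
Proof. by have [->|d0] := posnP d; [rewrite !divn0|nia]. Qed.

(** Legendre's formula, applied to [(2n)`! / (n`! * n`!)].  Each term of the sum is
    0 or 1, by [divn_double_bounds]. *)
Lemma logn_central_bin p n : prime p ->
  logn p 'C(n.*2, n)
    = \sum_(1 <= k < n.*2.+1) (n.*2 %/ p ^ k - (n %/ p ^ k + n %/ p ^ k)).
Proof.
move=> p_pr.
have := congr1 (logn p) (@bin_fact n.*2 n _).
rewrite (_ : n.*2 - n = n); last by lia.
rewrite !lognM ?muln_gt0 ?fact_gt0 ?bin_gt0; try lia.
rewrite !logn_fact // => /(_ _)/esym.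
have -> : \sum_(1 <= k < n.+1) n %/ p ^ k = \sum_(1 <= k < n.*2.+1) n %/ p ^ k.
  rewrite [RHS](@big_cat_nat _ _ _ n.+1) /=; [|lia|lia].
  rewrite [X in _ = _ + X]big_nat_cond [X in _ = _ + X]big1 ?addn0 // => k.
  rewrite andbT => /andP[nk _]; apply: divn_small.
  by apply: ltn_trans (ltn_expl _ (prime_gt1 p_pr)); lia.
move=> e; rewrite sumnB; last by move=> k _; case/andP: (divn_double_bounds n (p ^ k)).
by rewrite big_split /= e; lia.
Qed.

(** The terms with [p ^ k > 2 n] vanish in Legendre's formula and the others are
    at most 1, so the exponent of [p] is at most the logarithm of [2 n]. *)
Lemma expn_logn_central_bin p n :
  prime p -> 0 < n -> p ^ logn p 'C(n.*2, n) <= n.*2.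
Proof.
move=> p_pr n0; have p1 := prime_gt1 p_pr.
apply: leq_trans (trunc_logP p1 _); last by lia.
rewrite leq_exp2l // logn_central_bin //.
set t := trunc_log _ _.
have t2n : t <= n.*2.
  have := trunc_logP p1 (_ : 0 < n.*2); have := ltn_expl t p1; rewrite -/t; lia.
rewrite (@big_cat_nat _ _ _ t.+1) /=; [|lia|lia].
rewrite [X in _ + X]big_nat_cond [X in _ + X]big1 ?addn0; last first.
  move=> k; rewrite andbT => /andP[tk _]; rewrite divn_small //.
  by apply: leq_trans (trunc_log_ltn _ p1) _; rewrite leq_exp2l.
apply: leq_trans (_ : \sum_(1 <= k < t.+1) 1 <= _).
  by apply: leq_sum => k _; have := divn_double_bounds n (p ^ k); lia.
by rewrite sum_nat_const_nat; lia.
Qed.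

(** Here [2 n / p] and [n / p] round down to 2 and 1, and [p ^ 2 > 2 n], so every
    term of Legendre's formula vanishes. *)
Lemma logn_central_bin_mid p n :
  prime p -> n.*2 < 3 * p -> p <= n -> 2 < p -> logn p 'C(n.*2, n) = 0.
Proof.
move=> p_pr n3p pn p2; rewrite logn_central_bin //.
rewrite big_nat_cond big1 // => -[|[|k]]; rewrite ?andbT //= => _.
  rewrite expn1; have -> : n.*2 %/ p = 2 by nia.
  by have -> : n %/ p = 1 by nia.
rewrite divn_small //; apply: leq_trans n3p _.
apply: leq_trans (_ : p ^ 2 <= _); last by rewrite leq_exp2l // prime_gt1.
by rewrite expnS expn1 leq_mul2r p2 orbT.
Qed.

(** * Bertrand's postulate *)

(** Equality holds at 31, where both sides are [2 ^ 30].  This is why the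
    asymptotic argument starts at [2 n >= 31 ^ 2], that is [n >= 481]. *)
Lemma exp6_leq_exp2 s : 31 <= s -> s.+1 ^ 6 <= 2 ^ s.-1.
Proof.
elim: s => [//|s IHs]; rewrite leq_eqVlt => /predU1P[<-|s31].
  have e : 32 = 2 ^ 5 by [].
  by rewrite e -expnM leq_exp2l.
have {}IHs := IHs s31; rewrite -pred_Sn.
have -> : 2 ^ s = 2 * 2 ^ s.-1 by rewrite -expnS prednK //; lia.
apply: leq_trans (leq_mul (leqnn 2) IHs).
(* The ratio [(s + 2) / (s + 1)] is so close to 1 that its square is at most
   9/8, whose cube is less than 2. *)
have h : 8 * s.+2 ^ 2 <= 9 * s.+1 ^ 2 by nia.
rewrite (expnM s.+2 2 3) (expnM s.+1 2 3).
move: (s.+2 ^ 2) (s.+1 ^ 2) h => a b h.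
have : (8 * a) ^ 3 <= (9 * b) ^ 3 by rewrite leq_exp2r.
by rewrite !expnMn; move: (a ^ 3) (b ^ 3) => a3 b3; lia.
Qed.

(** With [s] the integer square root of [2 n], the absence of a prime in the range
    would give [2 ^ (s ^ 2) <= (s + 1) ^ (6 (s + 1))]; but by [exp6_leq_exp2] the
    right-hand side is at most [2 ^ (s ^ 2 - 1)]. *)
Lemma bertrand_large n : 481 <= n -> exists2 p, prime p & n < p <= n.*2.
Proof.
move=> n481; have n0 : 0 < n by lia.
pose B := 'C(n.*2, n); have B0 : 0 < B by rewrite bin_gt0; lia.
(* A prime factor of [B] is at most [2 n], so one above [n] will do. *)
have [/hasP[p]|/hasPn noP] := boolP (has [pred p | prime p & p > n] (primes B)).
  rewrite mem_primes => /and3P[p_pr _ pB] /andP[_ /= np]; exists p => //.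
  rewrite np /= leqNgt; apply/negP => pgt.
  have := expn_logn_central_bin p_pr n0; rewrite -/B.
  have : 0 < logn p B by rewrite logn_gt0 mem_primes p_pr B0.
  case: (logn p B) => // l _; rewrite expnS.
  have : 0 < p ^ l by rewrite expn_gt0 prime_gt0.
  by move: (p ^ l) => q q0; nia.
exfalso.
have [s /andP[s_le s_gt]] := ex_iroot n.*2 (isT : 0 < 2).
have s31 : 31 <= s by nia.
have BE : B = \prod_(p <- primes B) p ^ logn p B.
  by rewrite {1}(prod_prime_decomp B0) prime_decompE big_map.
(* At most [s] primes are at most [s], each contributing at most [2 n]. *)
have small : \prod_(p <- primes B | p <= s) p ^ logn p B <= n.*2 ^ s.
  rewrite -big_filter; apply: leq_trans (_ : \prod_(p <- [seq p <- primes B | p <= s]) n.*2 <= _).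
    rewrite big_seq [leqRHS]big_seq; apply: leq_prod => p.
    rewrite mem_filter mem_primes => /andP[_ /and3P[p_pr _ _]].
    exact: expn_logn_central_bin.
  rewrite big_const_seq iter_muln_1 count_predT leq_pexp2l //; first by lia.
  rewrite -[leqRHS](size_iota 1); apply: uniq_leq_size.
    exact/filter_uniq/primes_uniq.
  move=> p; rewrite mem_filter mem_primes mem_iota => /andP[ps /and3P[/prime_gt0]].
  by lia.
(* A prime above [s] has its square above [2 n], hence exponent at most 1. *)
have large : \prod_(p <- primes B | ~~ (p <= s)) p ^ logn p B <= 4 ^ (n.*2 %/ 3).
  rewrite -big_filter.
  apply: leq_trans (@prod_primes_leq _ [seq p <- primes B | ~~ (p <= s)] _ _).
  - rewrite big_seq [leqRHS]big_seq; apply: leq_prod => p.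
    rewrite mem_filter mem_primes => /andP[ps /and3P[p_pr _ _]].
    have := expn_logn_central_bin p_pr n0; rewrite -/B.
    case: (logn p B) => [|[|l]]; rewrite ?expn0 ?expn1 ?(prime_gt0 p_pr) //.
    rewrite !expnS; have : 0 < p ^ l by rewrite expn_gt0 prime_gt0.
    by nia.
  - exact/filter_uniq/primes_uniq.
  move=> p; rewrite mem_filter mem_primes => /andP[ps /and3P[p_pr _ pB]].
  rewrite p_pr /= leq_divRL // leqNgt; apply/negP => n3p.
  have pn : p <= n.
    by have := noP p; rewrite mem_primes p_pr B0 pB /= p_pr -leqNgt => /(_ isT).
  have : 0 < logn p B by rewrite logn_gt0 mem_primes p_pr B0.
  by rewrite logn_central_bin_mid //; lia.
have B_le : B <= n.*2 ^ s * 4 ^ (n.*2 %/ 3).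
  by rewrite {1}BE (bigID (fun p => p <= s)) /= leq_mul.
have le4 : 4 ^ n <= n.*2 ^ s.+1 * 4 ^ (n.*2 %/ 3).
  apply: leq_trans (exp4_leq_bin _) _; first by lia.
  by rewrite expnS -mulnA leq_mul2l B_le orbT.
have : 4 ^ (n - n.*2 %/ 3) <= n.*2 ^ s.+1.
  by rewrite -(@leq_pmul2r (4 ^ (n.*2 %/ 3))) ?expn_gt0 // -expnD subnK //; lia.
rewrite -(@leq_exp2r _ _ 3) // -!expnM => le3.
have : 2 ^ (s ^ 2) <= s.+1 ^ (6 * s.+1).
  apply: leq_trans (_ : 4 ^ ((n - n.*2 %/ 3) * 3) <= _).
    by rewrite (_ : 4 = 2 ^ 2) // -expnM leq_exp2l //; lia.
  apply: leq_trans le3 _.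
  apply: leq_trans (_ : (s.+1 ^ 2) ^ (s.+1 * 3) <= _); last first.
    by rewrite -expnM leq_exp2l; lia.
  by rewrite leq_exp2r; lia.
apply/negP; rewrite -ltnNge expnM.
apply: leq_ltn_trans (_ : (2 ^ s.-1) ^ s.+1 < _).
  by rewrite leq_exp2r // exp6_leq_exp2.
by rewrite -expnM ltn_exp2l //; nia.
Qed.

Lemma bertrand n : 0 < n -> exists2 p, prime p & n < p <= n.*2.
Proof.
move=> n0; have [/bertrand_large //|n481] := leqP 481 n.
(* Each prime of this list is less than twice the preceding one. *)
pose ps := [:: 2; 3; 5; 7; 13; 23; 43; 83; 163; 317; 631].
have ps_pr : all prime ps by vm_compute.
have : has (fun p => n < p <= n.*2) ps by rewrite /ps /=; lia.
by case/hasP=> p /(allP ps_pr); exists p.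
Qed.

(** * Short integer vectors on the moment curve *)

Lemma intr_pchar_eq0 (F : nzRingType) p (z : int) :
  p \in [pchar F]%R -> (z%:~R == 0 :> F)%R = (p %| `|z|).
Proof.
move=> ch; case: z => n; first by rewrite -(pmulrn 1 n) (dvdn_pcharf ch).
by rewrite NegzE rmorphN /= oppr_eq0 -(pmulrn 1 n.+1) (dvdn_pcharf ch).
Qed.

(** There are more vectors with entries in [[0, L]] than values of
    [(x_i - x_0 t ^ i)] for [0 < i <= d], so two of the vectors agree on these;
    their difference is the required vector. *)
Lemma ex_short_moment_multiple (F : finFieldType) d L (t : F) :
  #|F| ^ d < L.+1 ^ d.+1 ->
  exists2 z : 'rV[int]_d.+1, z != 0%R & forall i,
    `|z ord0 i|%N <= L /\ ((z ord0 i)%:~R = (z ord0 ord0)%:~R * t ^+ i)%R.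
Proof.
move=> FL.
pose f (x : {ffun 'I_d.+1 -> 'I_L.+1}) : {ffun 'I_d -> F} :=
  [ffun i => (x (lift ord0 i))%:R - (x ord0)%:R * t ^+ i.+1]%R.
have /injectivePn[x [y xy fxy]] : ~~ injectiveb f.
  apply/injectiveP => /leq_card; rewrite !card_ffun !card_ord.
  by rewrite leqNgt FL.
exists (\row_i ((x i)%:Z - (y i)%:Z))%R.
  apply: contra_neq xy => /matrixP z0; apply/ffunP => i.
  by have := z0 ord0 i; rewrite !mxE => /eqP; rewrite subr_eq0 => /eqP[/val_inj].
move=> i; rewrite !mxE; split; first by have := ltn_ord (x i); have := ltn_ord (y i); lia.
have [j ->|->] := unliftP ord0 i; last by rewrite expr0 mulr1.
have := congr1 (fun g : {ffun _ -> _} => g j) fxy; rewrite /f !ffunE => e.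
rewrite !rmorphB /= -!pmulrn mulrBl.
apply/eqP; rewrite -subr_eq0; move/eqP: e; rewrite -subr_eq0 !opprB.
by rewrite [X in (_ + X == _)%R]addrC addrACA [X in (_ + X == _)%R]addrC.
Qed.

(** Over [F] the matrix is a diagonal matrix times a transposed Vandermonde matrix,
    both invertible.  Its determinant is the image of the integral one, which is
    therefore nonzero, also in [R]. *)
Lemma moment_multiples_unitmx (R : realType) (F : fieldType) d (z : F -> 'rV[int]_d.+1)
    (s : 'I_d.+1 -> F) : injective s ->
  (forall t, (z t ord0 ord0)%:~R != 0 :> F)%R ->
  (forall t i, (z t ord0 i)%:~R = (z t ord0 ord0)%:~R * t ^+ i)%R ->
  (\matrix_(i, j) (z (s i) ord0 j)%:~R : 'M[R]_d.+1)%R \in unitmx.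
Proof.
move=> s_inj z0 zE.
pose A : 'M[int]_d.+1 := (\matrix_(i, j) z (s i) ord0 j)%R.
rewrite (_ : (\matrix_(i, j) _)%R = map_mx intr A); last first.
  by apply/matrixP => i j; rewrite !mxE.
rewrite unitmxE det_map_mx unitfE intr_eq0.
suff : ((\det A)%:~R != 0 :> F)%R by apply: contraNneq => ->.
rewrite -det_map_mx.
have -> : map_mx intr A = (diag_mx (\row_i (z (s i) ord0 ord0)%:~R) *m
    (Vandermonde d.+1 (\row_i s i))^T)%R :> 'M[F]_d.+1.
  by apply/matrixP => i j; rewrite mul_diag_mx !mxE zE.
rewrite det_mulmx det_diag det_tr det_Vandermonde mulf_neq0 //.
  by apply/prodf_neq0 => i _; rewrite mxE.
apply/prodf_neq0 => i _; apply/prodf_neq0 => j ij; rewrite !mxE subr_eq0.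
by apply: contraTneq ij => /s_inj ->; rewrite ltnn.
Qed.

Lemma dim_unitmx_rows (F : fieldType) n (A : 'M[F]_n) (V : {vspace 'rV[F]_n}) :
  A \in unitmx -> (forall i, row i A \in V) -> \dim V = n.
Proof.
move=> uA AV; suff -> : V = fullv by rewrite dimvf /dim /= mul1n.
apply/eqP; rewrite eqEsubv subvf; apply/subvP => v _.
rewrite -(mulmxKV uA v) mulmx_sum_row.
by apply: memv_suml => i _; apply: memvZ.
Qed.

(** * Counting points on hyperplanes *)

Lemma card_moment_multiples_hyperplane (R : realType) (F : finFieldType) d
    (z : F -> 'rV[int]_d.+1) (V : {vspace 'rV[R]_d.+1}) :
  (forall t, (z t ord0 ord0)%:~R != 0 :> F)%R ->
  (forall t i, (z t ord0 i)%:~R = (z t ord0 ord0)%:~R * t ^+ i)%R ->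
  \dim V = d -> #|[pred t | map_mx intr (z t) \in V]| <= d.
Proof.
move=> z0 zE dimV; rewrite leqNgt; apply/negP => dT.
pose s i := enum_val (widen_ord dT i).
have s_inj : injective s by move=> i j /enum_val_inj/(congr1 val)/= /ord_inj.
have uA := moment_multiples_unitmx R s_inj z0 zE.
have := dim_unitmx_rows (V := V) uA.
rewrite dimV => /(_ _)/n_Sn[] // i.
have -> : row i (\matrix_(i, j) (z (s i) ord0 j)%:~R)%R = map_mx intr (z (s i)) :> 'rV[R]_d.+1.
  by apply/rowP => j; rewrite !mxE.
by have := enum_valP (widen_ord dT i); rewrite inE.
Qed.

(** Each member of the cover takes at most [d] of the [#|F|] points [x_t].  The
    first hypothesis says that [F] is a prime field. *)
Lemma hyperplane_cover_card (R : realType) (F : finFieldType) d k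
    (S : {fset {vspace 'rV[R]_d.+1}}) :
  #|F| \in [pchar F]%R -> #|F| ^ d <= k ^ d.+1 ->
  hyperplane_cover (grid R d.+1 k) S ->
  #|F| <= #|` S|%fset * d.
Proof.
set p := #|F|; move=> ch pk [dimS covS].
(* [L] is the integer part of [p ^ (d / (d + 1))]: the box [[0, L] ^ (d + 1)] has
   more than [p ^ d] points, while [L < p] and [L <= k]. *)
have [L /andP[Lp pL]] := ex_iroot (p ^ d) (isT : 0 < d.+1).
have L_lt_p : L < p.
  have p_pr := pcharf_prime ch.
  by rewrite -(@ltn_exp2r _ _ d.+1) // (leq_ltn_trans Lp) // ltn_exp2l // prime_gt1.
have L_le_k : L <= k by rewrite -(@leq_exp2r _ _ d.+1) // (leq_trans Lp).
have /choice[z zP] : forall t : F, exists z : 'rV[int]_d.+1, z != 0%R /\ forall i,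
    `|z ord0 i|%N <= L /\ ((z ord0 i)%:~R = (z ord0 ord0)%:~R * t ^+ i)%R.
  by move=> t; have [z] := ex_short_moment_multiple t pL; exists z.
have zE t i : ((z t ord0 i)%:~R = (z t ord0 ord0)%:~R * t ^+ i)%R.
  by have [_ /(_ i)[]] := zP t.
have zL t i : `|z t ord0 i|%N <= L by have [_ /(_ i)[]] := zP t.
(* If the first entry vanished modulo [p], all entries would, and they are
   smaller than [p]. *)
have z0 t : ((z t ord0 ord0)%:~R != 0 :> F)%R.
  have [+ _] := zP t; apply: contra_neq => z00.
  apply/matrixP => i j; rewrite (ord1 i) mxE.
  have /eqP := zE t j; rewrite z00 mul0r (intr_pchar_eq0 _ ch) => pz.
  apply/eqP; rewrite -absz_eq0 -leqn0 leqNgt; apply/negP => /dvdn_leq/(_ pz).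
  by rewrite leqNgt (leq_ltn_trans (zL t j)).
pose x t : 'rV[R]_d.+1 := map_mx intr (z t).
have /choice[g gP] : forall t, exists V : S, x t \in val V.
  move=> t; have [|V VS xV] := covS (x t); last by exists [` VS]%fset.
  split; first by exists (z t).
  rewrite [leLHS]/Num.norm /= mx_normrE; apply: bigmax_le => //= -[i j] _ /=.
  rewrite mxE (ord1 i) -intr_norm -[k%:R%R]/(k%:Z%:~R)%R ler_int.
  by rewrite -abszE lez_nat (leq_trans (zL t j)).
rewrite /p -sum1_card (partition_big g xpredT) // cardfE.
rewrite -sum_nat_const; apply: leq_sum => V _; rewrite sum1_card.
apply: leq_trans (_ : #|[pred t | x t \in val V]| <= d).
  apply/subset_leq_card/fintype.subsetP => t gtV.
  have <- : g t = V by exact/eqP.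
  exact: gP.
by apply: card_moment_multiples_hyperplane => //; rewrite dimS ?subn1 // fsvalP.
Qed.

(** * The lower bound *)

Local Open Scope ring_scope.

Theorem corollary1p4 (R : realType) (k m : nat) (hm : (2 <= m)%N)
    (hk : (m <= k)%N) :
  k%:R `^ (m%:R / (m%:R - 1)) / (2 * m%:R - 2) <= (min_cover R m k hm)%:R :> R.
Proof.
case: m hm hk => [//|d] hm hk; have d0 : (0 < d)%N by [].
rewrite /min_cover; case: ex_minnP => M /asboolP[S covS cardS] _.
(* [N] is the integer part of [k ^ (m / (m - 1))], where [m = d + 1].  A prime
   [p] in the interval from [N / 2] to [2 (N / 2)] (halves rounded down) has both
   [p <= N] and [N + 1 <= 2 p]. *)
have [N /andP[Nk kN]] := ex_iroot (k ^ d.+1) d0.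
have N2 : (2 <= N)%N.
  rewrite -ltnS -(@ltn_exp2r _ _ d) // (leq_ltn_trans _ kN) //.
  by rewrite (@leq_trans (2 ^ d.+1)%N) // ?leq_exp2l // leq_exp2r // (leq_trans hm).
have [p p_pr /andP[Np pN]] := @bertrand N./2 ltac:(lia).
have pM : (p <= M * d)%N.
  rewrite -cardS -{1}(card_Fp p_pr); apply: hyperplane_cover_card covS.
    by rewrite card_Fp // pchar_Fp.
  rewrite card_Fp // (leq_trans _ Nk) // leq_exp2r // (leq_trans pN) //.
  by lia.
have root_le : k%:R `^ (d.+1%:R / d%:R) <= (2 * p)%:R :> R.
  have le1 : ((k ^ d.+1)%N%:R : R) <= ((2 * p) ^ d)%N%:R.
    by rewrite ler_nat (leq_trans (ltnW kN)) // leq_exp2r //; lia.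
  have dr0 : (d%:R != 0 :> R) by rewrite pnatr_eq0 -lt0n.
  rewrite powRrM powR_mulrn // -natrX.
  apply: le_trans (ge0_ler_powR _ _ _ le1) _; rewrite ?nnegrE ?invr_ge0 //.
  by rewrite natrX -powR_mulrn // -powRrM mulfV // powRr1.
rewrite -[d.+1%:R - 1]/(d.+1%:R - 1%:R) -natrB // subn1 /=.
have -> : 2 * d.+1%:R - 2 = (2 * d)%:R :> R.
  by rewrite -(natr1 d) mulrDr mulr1 addrK natrM.
rewrite ler_pdivrMr ?ltr0n ?muln_gt0 //; apply: le_trans root_le _.
by rewrite -natrM ler_nat; lia.
Qed.
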